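(* Let $\mu,\upsilon>-1$, $0<\rho\le1$, and let $N\ge1$ be an integer. For any $\phi\in P_N^\rho(J)$ the following inverse estimates hold: $$\|\partial_t\phi\|_{0,\tilde\varkappa^{\mu,\upsilon,\rho}}\le\sqrt{\sigma_N^{\mu,\upsilon}}\;\|\phi\|_{0,\varkappa^{\mu,\upsilon,\rho}},$$ and $$\|\mathcal{D}_\rho^k\phi\|_{0,\varkappa^{\mu+k,\upsilon+k,\rho}}\le cN^k\|\phi\|_{0,\varkappa^{\mu,\upsilon,\rho}},\qquad k\ge1,$$ where $\sigma_N^{\mu,\upsilon}=N(N+\mu+\upsilon+1)$ and, for fixed $k$, $c$ is a constant independent of $N$ and $\phi$.
   Context: $J=[0,1]$. $P_N^\rho(J)=\mathrm{span}\{1,(1-t)^\rho,(1-t)^{2\rho},\dots,(1-t)^{N\rho}\}$. The weights are $\varkappa^{a,b,\rho}(t)=\rho(1-t)^{\rho(a+1)-1}\bigl(1-(1-t)^\rho\bigr)^b$ and $\tilde\varkappa^{\mu,\upsilon,\rho}(t)=\rho^{-1}(1-t)^{\rho\mu+1}\bigl(1-(1-t)^\rho\bigr)^{\upsilon+1}$. For a weight $\varkappa$, $\|f\|_{0,\varkappa}=(\int_0^1f^2\varkappa\,dt)^{1/2}$. $\mathcal{D}_\rho f(t)=\frac{(1-t)^{1-\rho}}{\rho}f'(t)$, and $\mathcal{D}_\rho^k$ is its $k$-fold composition. *)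

(* Defs.v *)
From mathcomp Require Import all_boot all_order all_algebra.
From mathcomp Require Import all_classical all_reals all_analysis.
Import Order.TTheory GRing.Theory Num.Theory.
Import numFieldNormedType.Exports.

Set Implicit Arguments.
Unset Strict Implicit.
Unset Printing Implicit Defensive.

Local Open Scope classical_set_scope.
Local Open Scope ring_scope.

(* A function on J = [0, 1] is represented by a total function R -> R whose
   values outside J are unconstrained.  Derivatives are only meaningful in the
   open interval ]0, 1[; the two end points are Lebesgue-negligible in every
   norm below. *)
Definition unitJ {R : realType} : set R := `[0, 1].

Definition fracpoly {R : realType} (rho : R) (N : nat) : set (R -> R) :=
  [set phi | exists a : 'I_N.+1 -> R, forall t, unitJ t ->
    phi t = \sum_(j < N.+1) a j * (1 - t) `^ (j%:R * rho)].

Definition weight {R : realType} (a b rho : R) (t : R) : R :=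
  rho * (1 - t) `^ (rho * (a + 1) - 1) * (1 - (1 - t) `^ rho) `^ b.

Definition tweight {R : realType} (mu upsilon rho : R) (t : R) : R :=
  rho^-1 * (1 - t) `^ (rho * mu + 1) *
  (1 - (1 - t) `^ rho) `^ (upsilon + 1).

(* Extended-real valued: it is +oo, not a junk real, if f^2 w has an infinite
   integral. *)
Definition wnorm {R : realType} (w f : R -> R) : \bar R :=
  ((\int[@lebesgue_measure R]_(t in unitJ) (f t ^+ 2 * w t)%:E) `^ (2^-1)%R)%E.

Definition Drho {R : realType} (rho : R) (f : R -> R) : R -> R :=
  fun t => (1 - t) `^ (1 - rho) / rho * (f^`())%classic t.

Definition sigmaN {R : realType} (mu upsilon : R) (N : nat) : R :=
  N%:R * (N%:R + mu + upsilon + 1).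

(* Main.v *)
(* With x = (1 - t)^rho an element of P_N^rho is p(x) for a polynomial p of degree
   at most N, Drho acts as p |-> - p', and the weight pushes forward to
   x^a (1 - x)^b dx.  Both estimates thus reduce to the inequality
     int p'^2 x^(a+1) (1-x)^(b+1) <= N (N+a+b+1) int p^2 x^a (1-x)^b.
   It follows by induction on N from the splitting p = c j + r, where j is the monic
   polynomial of degree N orthogonal to all lower degrees: the Jacobi operator A
   is symmetric by integration by parts and A j = N (N+a+b+1) j + lower terms,
   so the cross terms vanish. *)

Require Import Defs.
From mathcomp Require Import all_boot all_order all_algebra.
From mathcomp Require Import ring lra.
From mathcomp Require Import all_classical all_reals all_analysis.
From mathcomp Require Import measurable_realfun.
Import Order.TTheory GRing.Theory Num.Theory.
Import numFieldNormedType.Exports.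

Set Implicit Arguments.
Unset Strict Implicit.
Unset Printing Implicit Defensive.

Local Open Scope classical_set_scope.
Local Open Scope ring_scope.

(** * The Jacobi operator and the inverse inequality for an abstract moment functional *)

Section JacobiFunctional.
Variables (R : realFieldType) (L : {poly R} -> R).
Hypothesis L_scalar : scalar L.
Hypothesis L_sqr_ge0 : forall p, 0 <= L (p ^+ 2).

Let LD p q : L (p + q) = L p + L q.
Proof. by have := L_scalar 1 p q; rewrite scale1r mul1r. Qed.

Let L0 : L 0 = 0.
Proof.
by have := LD 0 0; rewrite addr0 => /eqP; rewrite addrC -subr_eq subrr => /eqP.
Qed.

Let LZ c p : L (c *: p) = c * L p.
Proof. by have := L_scalar c p 0; rewrite !addr0 L0 addr0. Qed.

Let LB p q : L (p - q) = L p - L q.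
Proof. by rewrite -scaleN1r LD LZ mulN1r. Qed.

(* Semidefinite Cauchy-Schwarz: lets the projection below exist without L being
   definite. *)
Lemma isotropic_orthogonal (j q : {poly R}) : L (j ^+ 2) = 0 -> L (j * q) = 0.
Proof.
move=> Lj; apply/eqP; apply: contraT => s0.
set s := L (j * q) in s0.
(* Chosen so that the square of [q + c *: j], affine in [c] because [j] is isotropic, would have
   moment -1. *)
pose c := - (L (q ^+ 2) + 1) / (2 * s).
have := L_sqr_ge0 (q + c *: j).
have -> : (q + c *: j) ^+ 2 = q ^+ 2 + (2 * c) *: (j * q) + (c ^+ 2) *: (j ^+ 2).
  by rewrite -!mul_polyC; ring.
rewrite !LD !LZ Lj mulr0 addr0 -/s.
have -> : L (q ^+ 2) + 2 * c * s = -1 by rewrite /c; field.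
by rewrite ler0N1.
Qed.

(** Gram-Schmidt by induction on [n]: the projection onto degree below [n] is corrected along [j],
    the monic polynomial of degree [n] orthogonal to all lower degrees, which comes from projecting
    the monomial itself. *)
Lemma orthogonal_projection (n : nat) (p : {poly R}) :
  exists2 r : {poly R}, (size r <= n)%N &
    forall q : {poly R}, (size q <= n)%N -> L ((p - r) * q) = 0.
Proof.
elim: n p => [|n IHn] p.
  exists 0; first by rewrite size_poly0.
  by move=> q; rewrite leqn0 size_poly_eq0 => /eqP ->; rewrite mulr0.
have [s ss sP] := IHn ('X^n)%R; have [r sr rP] := IHn p.
set j := 'X^n - s in sP.
pose c := L ((p - r) * j) / L (j ^+ 2).
exists (r + c *: j).
  rewrite (leq_trans (size_polyD _ _))// geq_max (leq_trans sr)//=.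
  rewrite (leq_trans (size_scale_leq _ _))// (leq_trans (size_polyD _ _))//.
  by rewrite geq_max size_polyXn leqnn size_polyN (leq_trans ss).
(* Removing the leading term along [j] leaves [q1] of degree below [n], to which both induction
   hypotheses apply. *)
move=> q sq; pose q1 := q - q`_n *: j.
have sq1 : (size q1 <= n)%N.
  apply/leq_sizeP => i ni; rewrite coefB coefZ coefB coefXn.
  move: ni; rewrite leq_eqVlt => /predU1P[<-|ni].
    by rewrite eqxx (leq_sizeP _ _ ss)// subr0 mulr1 subrr.
  rewrite gtn_eqF// (leq_sizeP _ _ ss) ?(ltnW ni)// subrr mulr0.
  by rewrite (leq_sizeP _ _ sq)// subrr.
have -> : (p - (r + c *: j)) * q =
    q`_n *: ((p - r) * j) - (q`_n * c) *: (j ^+ 2) + (p - r) * q1 - c *: (j * q1).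
  by rewrite /q1 -!mul_polyC; ring.
rewrite LB LD LB !LZ (rP q1 sq1) (sP q1 sq1) mulr0 subr0 addr0 -mulrA.
(* If [j] is isotropic, the value of [c] does not matter: [j] is then orthogonal to everything. *)
have [j0|j0] := eqVneq (L (j ^+ 2)) 0; last by rewrite /c divfK// subrr.
by rewrite j0 (mulrC (p - r)) isotropic_orthogonal// !mulr0 subr0.
Qed.

Variables (a b : R).

(** For the density W = x^a (1-x)^b one has (w W)' = v W, hence (w q W)' = (w q' + v q) W. The
    hypothesis [L_ibp] thus says that the boundary terms of w q W cancel. *)
Let w : {poly R} := 'X * (1 - 'X).
Let v : {poly R} := (a + 1) *: (1 - 'X) - (b + 1) *: 'X.
Let sig (n : nat) : R := n%:R * (n%:R + a + b + 1).

Hypothesis L_ibp : forall q, L (w * q^`() + v * q) = 0.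
Hypothesis ab_gt : -2 < a + b.

(* The Jacobi differential operator: symmetric for the form L (p * r) and
   triangular on monomials, with eigenvalues sig. *)
Let A (p : {poly R}) : {poly R} := - (w * p^`()^`() + v * p^`()).

Let coef_A p i : (A p)`_i = sig i * p`_i - i.+1%:R * (i%:R + a + 1) * p`_i.+1.
Proof.
have -> : A p = p^`()^`() * 'X * 'X - p^`()^`() * 'X
    + (a + b + 2) *: (p^`() * 'X) - (a + 1) *: p^`().
  rewrite /A /w /v -!mul_polyC; ring.
rewrite !(coefB, coefD, coefZ, coefMX, coef_deriv) /sig.
case: i => [|[|i]] /=; ring.
Qed.

(** The two arguments of [L] differ by the total derivative obtained from [L_ibp] at p' r. The left
    side is symmetric in [p] and [r], so [A] is symmetric for the form. *)
Let A_sym p r : L (w * p^`() * r^`()) = L (A p * r).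
Proof.
have := L_ibp (p^`() * r); rewrite derivM => h.
have -> : w * p^`() * r^`() =
    (w * (p^`()^`() * r + p^`() * r^`()) + v * (p^`() * r)) + A p * r.
  by rewrite /A; ring.
by rewrite LD h add0r.
Qed.

Let size_A_sub n (p : {poly R}) : (size p <= n.+1)%N ->
  (size (A p - sig n *: p)%R <= n)%N.
Proof.
move=> /leq_sizeP sp; apply/leq_sizeP => i ni.
rewrite coefB coefZ coef_A (sp i.+1)// mulr0 subr0.
move: ni; rewrite leq_eqVlt => /predU1P[->|ni]; first by rewrite subrr.
by rewrite sp// !mulr0 subrr.
Qed.

Lemma Jacobi_markov (n : nat) (p : {poly R}) : (size p <= n.+1)%N ->
  L ('X * (1 - 'X) * p^`() ^+ 2) <= n%:R * (n%:R + a + b + 1) * L (p ^+ 2).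
Proof.
rewrite -/w -/(sig n); elim: n p => [|n IHn] p sp.
  by rewrite (size1_polyC sp) derivC expr0n mulr0 L0 /sig !mul0r.
have [s ss sP] := orthogonal_projection n.+1 ('X^(n.+1))%R.
set j := 'X^(n.+1) - s in sP.
have sj : (size j <= n.+2)%N.
  rewrite (leq_trans (size_polyD _ _))// geq_max size_polyXn leqnn size_polyN.
  exact: leq_trans ss _.
pose c := p`_n.+1; pose r := p - c *: j.
have sr : (size r <= n.+1)%N.
  apply/leq_sizeP => i ni; rewrite coefB coefZ coefB coefXn.
  move: ni; rewrite leq_eqVlt => /predU1P[<-|ni].
    by rewrite eqxx (leq_sizeP _ _ ss)// subr0 mulr1 subrr.
  rewrite gtn_eqF// (leq_sizeP _ _ ss) ?(ltnW ni)// subrr mulr0.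
  by rewrite (leq_sizeP _ _ sp)// subrr.
have -> : p = c *: j + r by rewrite /r subrKC.
have Ljr : L (j * r) = 0 by apply: sP.
(* [A] does not raise degrees, so [A r] stays among the polynomials orthogonal to [j]. *)
have LjAr : L (A r * j) = 0.
  rewrite mulrC; apply: sP.
  rewrite -(subrK (sig n *: r) (A r)) (leq_trans (size_polyD _ _))// geq_max.
  rewrite (leq_trans (size_A_sub sr))//=.
  by rewrite (leq_trans (size_scale_leq _ _)).
have LAjj : L (A j * j) = sig n.+1 * L (j ^+ 2).
  rewrite -(subrK (sig n.+1 *: j) (A j)) mulrDl LD mulrC sP ?size_A_sub// add0r.
  by rewrite -scalerAl LZ -expr2.
have -> : w * (c *: j + r)^`() ^+ 2 = c ^+ 2 *: (w * j^`() * j^`())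
    + (2 * c) *: (w * r^`() * j^`()) + w * r^`() ^+ 2.
  rewrite derivD derivZ -!mul_polyC; ring.
have -> : (c *: j + r) ^+ 2 = c ^+ 2 *: j ^+ 2 + (2 * c) *: (j * r) + r ^+ 2.
  rewrite -!mul_polyC; ring.
(* The contributions of [j] to the two sides are equal and cancel. What remains is the inequality
   for [r], with the larger eigenvalue [sig n.+1] in place of [sig n]. *)
rewrite !LD !LZ !A_sym LAjj LjAr Ljr !mulr0 !addr0 mulrDr mulrCA lerD2l.
rewrite (le_trans (IHn _ sr))// ler_wpM2r ?L_sqr_ge0// -subr_ge0.
have -> : sig n.+1 - sig n = 2 * n%:R + (a + b + 2) by rewrite /sig; ring.
by rewrite addr_ge0 ?mulr_ge0// -lerBlDr sub0r ltW.
Qed.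

End JacobiFunctional.

(** * The fundamental theorem of calculus on an open interval, for integrands possibly unbounded at
    the ends *)

(** Exhaust the open interval by compact ones, apply the usual theorem on each, and pass to the
    limit by monotone convergence. *)
Lemma ge0_FTC2_oo (R : realType) (f F : R -> R) (a b la lb : R) : a < b ->
  {in `]a, b[, forall x, 0 <= f x} ->
  {in `]a, b[, forall x, {for x, continuous f}} ->
  {in `]a, b[, forall x : R, is_derive x (1 : R) F (f x)} ->
  F x @[x --> a^'+] --> la -> F x @[x --> b^'-] --> lb ->
  (\int[@lebesgue_measure R]_(x in `]a, b[) (f x)%:E = (lb - la)%:E)%E.
Proof.
move=> ab f0 cf dF Fa Fb.
(* The factor 1/3 makes even the first compact interval nondegenerate. *)
pose e (n : nat) : R := (b - a) / 3 * harmonic n.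
have e_gt0 n : 0 < e n by rewrite mulr_gt0 ?divr_gt0 ?subr_gt0// invr_gt0.
have e_le n : e n <= (b - a) / 3.
  by rewrite ger_pMr ?divr_gt0 ?subr_gt0// invf_le1// ler1n.
have e_dec m n : (m <= n)%N -> e n <= e m.
  by move=> mn; rewrite ler_pM2l ?divr_gt0 ?subr_gt0// lef_pV2 ?posrE// ler_nat ltnS.
have e_cvg : e n @[n --> \oo] --> (0 : R).
  rewrite -(mulr0 ((b - a) / 3)); apply: cvgM; first exact: cvg_cst.
  exact: cvg_harmonic.
pose c n := a + e n; pose d n := b - e n.
have c_cvg : c n @[n --> \oo] --> a.
  by rewrite -[X in _ --> X]addr0; apply: cvgD => //; exact: cvg_cst.
have d_cvg : d n @[n --> \oo] --> b.
  by rewrite -[X in _ --> X]subr0; apply: cvgB => //; exact: cvg_cst.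
have ac n : a < c n by rewrite ltrDl.
have db n : d n < b by rewrite ltrBlDr ltrDl.
have cd n : c n < d n by have := e_le n; rewrite /c /d; lra.
have sub n : {subset `[c n, d n] <= `]a, b[}.
  move=> x; rewrite !in_itv/= => /andP[cx xd].
  by rewrite (lt_le_trans (ac n) cx) (le_lt_trans xd (db n)).
have -> : `]a, b[%classic = \bigcup_n `[c n, d n]%classic.
  apply/seteqP; split => x /=; last by case=> n _ /= /sub.
  rewrite in_itv/= => /andP[ax xb].
  have [N _ HN] : \forall n \near \oo, c n < x /\ x < d n.
    by near=> n; split; near: n; [exact: (cvgr_lt a)|exact: (cvgr_gt b)].
  by exists N => //=; have [? ?] := HN N (leqnn N); rewrite in_itv/= !ltW.
have cfn n : {within `[c n, d n], continuous f}.
  by apply: continuous_in_subspaceT => x; rewrite inE/= => /sub; exact: cf.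
have intn n : (\int[@lebesgue_measure R]_(x in `[c n, d n]) (f x)%:E =
    (F (d n) - F (c n))%:E)%E.
  have Fd x : x \in `[c n, d n] -> is_derive x (1 : R) F (f x).
    by move=> /sub; exact: dF.
  rewrite EFinB; apply: continuous_FTC2 => //.
    have /continuous_within_itvP-/(_ (cd n))[_ Fc Fd'] :
        {within `[c n, d n], continuous F}.
      by apply: derivable_within_continuous => x /Fd [].
    split => // x /subset_itv_oo_cc xcd.
    by have [] := Fd x xcd.
  move=> x /subset_itv_oo_cc xcd.
  by rewrite derive1E; have [] := Fd x xcd.
have cvI : (\int[@lebesgue_measure R]_(x in `[c n, d n]) (f x)%:E)%E @[n --> \oo] -->
    (\int[@lebesgue_measure R]_(x in \bigcup_n `[c n, d n]%classic) (f x)%:E)%E.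
  apply: ge0_nondecreasing_set_cvg_integral.
  - move=> m n mn; apply/subsetPset => x /=; rewrite !in_itv/= => /andP[cx xd].
    have := e_dec _ _ mn; rewrite /c /d in cx xd *; lra.
  - by move=> n; exact: measurable_itv.
  - move=> n; apply/measurable_EFinP.
    by apply: subspace_continuous_measurable_fun => //; exact: measurable_itv.
  - by move=> n x /= /sub xab; rewrite lee_fin f0.
apply: (cvg_unique _ cvI) => //.
rewrite (_ : (fun n => _) = (fun n => (F (d n) - F (c n))%:E)); last exact/funext.
apply: cvg_EFin; first exact: nearW.
apply: cvgB.
  by move/cvg_at_leftP : Fb; apply.
by move/cvg_at_rightP : Fa; apply.
Unshelve. all: by end_near. Qed.

(** The integral of the majorant [g] is finite, because its antiderivative [G] has finite limits at
    both ends. *)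
Lemma integrable_FTC2_oo (R : realType) (f g G : R -> R) (a b ma mb : R) : a < b ->
  {in `]a, b[, forall x, `|f x| <= g x} ->
  {in `]a, b[, forall x, {for x, continuous f}} ->
  {in `]a, b[, forall x, {for x, continuous g}} ->
  {in `]a, b[, forall x : R, is_derive x (1 : R) G (g x)} ->
  G x @[x --> a^'+] --> ma -> G x @[x --> b^'-] --> mb ->
  (@lebesgue_measure R).-integrable `]a, b[ (EFin \o f).
Proof.
move=> ab fg cf cg dG Ga Gb.
have g0 : {in `]a, b[, forall x, 0 <= g x}.
  by move=> x /fg; exact: le_trans.
have mf : measurable_fun `]a, b[ f.
  by apply: open_continuous_measurable_fun => // x /set_mem; exact: cf.
have mg : measurable_fun `]a, b[ g.
  by apply: open_continuous_measurable_fun => // x /set_mem; exact: cg.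
have ig : lebesgue_measure.-integrable `]a, b[ (EFin \o g).
  apply/integrableP; split; first exact/measurable_EFinP.
  under eq_integral => x /set_mem xab do rewrite /= ger0_norm ?g0//.
  by rewrite (ge0_FTC2_oo ab g0 cg dG Ga Gb) ltry.
apply: (le_integrable _ _ _ ig) => //; first exact/measurable_EFinP.
by move=> x xab /=; rewrite lee_fin (le_trans (fg x xab))// ler_norm.
Qed.

(* Apply the monotone version to g and to f + g. *)
Lemma FTC2_oo (R : realType) (f F g G : R -> R) (a b la lb ma mb : R) : a < b ->
  {in `]a, b[, forall x, `|f x| <= g x} ->
  {in `]a, b[, forall x, {for x, continuous f}} ->
  {in `]a, b[, forall x, {for x, continuous g}} ->
  {in `]a, b[, forall x : R, is_derive x (1 : R) F (f x)} ->
  {in `]a, b[, forall x : R, is_derive x (1 : R) G (g x)} ->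
  F x @[x --> a^'+] --> la -> F x @[x --> b^'-] --> lb ->
  G x @[x --> a^'+] --> ma -> G x @[x --> b^'-] --> mb ->
  (\int[@lebesgue_measure R]_(x in `]a, b[) (f x)%:E = (lb - la)%:E)%E.
Proof.
move=> ab fg cf cg dF dG Fa Fb Ga Gb.
have g0 : {in `]a, b[, forall x, 0 <= g x}.
  by move=> x /fg; exact: le_trans.
have intG := ge0_FTC2_oo ab g0 cg dG Ga Gb.
have if_ := integrable_FTC2_oo ab fg cf cg dG Ga Gb.
have ig : (@lebesgue_measure R).-integrable `]a, b[ (EFin \o g).
  apply: (integrable_FTC2_oo ab _ cg cg dG Ga Gb) => x /g0 gx.
  by rewrite ger0_norm.
have : (\int[@lebesgue_measure R]_(x in `]a, b[) (f x + g x)%:E =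
    (lb + mb - (la + ma))%:E)%E.
  apply: (@ge0_FTC2_oo _ _ (fun x => F x + G x)) => //.
  - by move=> x xab; have := fg x xab; rewrite ler_norml => /andP[]; lra.
  - by move=> x xab; apply: continuousD; [exact: cf|exact: cg].
  - by move=> x xab; have ? := dF x xab; have ? := dG x xab; apply: is_deriveD.
  - exact: cvgD.
  - exact: cvgD.
under eq_integral do rewrite EFinD.
rewrite integralD//= intG.
rewrite -[X in (X + _)%E = _ -> _]fineK; last exact: integrable_fin_num.
rewrite -[in X in _ -> X](@fineK _ (\int[_]_(x in _) _)); last exact: integrable_fin_num.
rewrite -EFinD => -[h]; congr EFin; move: h => /=; lra.
Qed.

(** * Derivatives, limits and bounds of real powers *)

Section PowR.
Variable R : realType.

Lemma powRD1 (x c : R) : 0 < x -> x `^ (c + 1) = x `^ c * x.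
Proof.
by move=> x0; rewrite powRD ?(gt_eqF x0) ?implybT// powRr1// ltW.
Qed.

Lemma is_derive_onem_powR (c t : R) : t < 1 ->
  is_derive t (1 : R) (fun t => (1 - t) `^ c) (- (c * (1 - t) `^ (c - 1))).
Proof.
move=> t1; have t1' : 0 < 1 - t by rewrite subr_gt0.
have d1 : is_derive t (1 : R) (fun t : R => 1 - t) (-1 : R).
  have h := is_deriveB (is_derive_cst (1 : R) t 1) (is_derive_id t (1 : R)).
  by apply: is_derive_eq h _; rewrite sub0r.
have h := is_derive1_comp (g := fun t : R => 1 - t) (is_derive1_powR c t1') d1.
by apply: is_derive_eq h _; rewrite mulrN1.
Qed.

Lemma is_derive1_continuous (f : R -> R) (x df : R) :
  is_derive x (1 : R) f df -> {for x, continuous f}.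
Proof. by case=> + _ => /derivable1_diffP/differentiable_continuous. Qed.

(** Positivity turns convergence to 0 into convergence to 0 from the right, where [powR_cvg0]
    applies. *)
Lemma powR_cvg0_comp (T : Type) (F : set_system T) {FF : Filter F} (f : T -> R) (c : R) :
  0 < c -> (\forall x \near F, 0 < f x) -> f x @[x --> F] --> 0 ->
  f x `^ c @[x --> F] --> 0.
Proof.
move=> c0 fpos f0; have fr : f x @[x --> F] --> 0^'+.
  by move=> A /f0 hA; apply: filterS2 hA fpos => x /= h /h.
exact: cvg_comp fr (powR_cvg0 c0).
Qed.

Lemma onem_powR_cvg_left c : 0 < c -> (1 - t) `^ c @[t --> (1 : R)^'-] --> 0.
Proof.
move=> c0; apply: powR_cvg0_comp => //.
  by near=> t; rewrite subr_gt0.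
rewrite -[Z in _ --> Z](subrr (1 : R)); apply: cvg_at_left_filter.
by apply: cvgB; [exact: cvg_cst|exact: cvg_id].
Unshelve. all: by end_near. Qed.

Lemma onem_powR_cvg_right c : (1 - t) `^ c @[t --> (0 : R)^'+] --> (1 : R).
Proof.
apply: cvg_at_right_filter.
have := is_derive1_continuous (is_derive_onem_powR c (@ltr01 R)).
by rewrite /prop_for /continuous_at subr0 powR1.
Qed.

(* Since a, b > -1, the factor whose base is at least 1/2 is at most 2. *)
Lemma powRM_onem_le (a b x : R) : -1 < a -> -1 < b -> 0 < x < 1 ->
  x `^ a * (1 - x) `^ b <= 2 * (x `^ a + (1 - x) `^ b).
Proof.
have half (c y : R) : -1 < c -> 2^-1 <= y <= 1 -> y `^ c <= 2.
  move=> c1 /andP[y2 y1]; have y0 : 0 < y by apply: lt_le_trans y2.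
  (* For a base in ]0, 1] the power decreases with the exponent, so the exponent -1 is the worst
     case. *)
  apply: (@le_trans _ _ (y `^ (-1))).
    by apply: ger_powR; [rewrite y0|exact: ltW].
  by rewrite powR_inv1 ?(ltW y0)// -[leRHS]invrK lef_pV2// posrE.
move=> a1 b1 /andP[x0 x1].
have [x2|x2] := leP x 2^-1.
  have := half b (1 - x) b1; have := powR_ge0 x a; have := powR_ge0 (1 - x) b.
  move: (x `^ a) ((1 - x) `^ b) => u v v0 u0 h.
  have {h}v2 : v <= 2 by apply: h; lra.
  nra.
have := half a x a1; have := powR_ge0 x a; have := powR_ge0 (1 - x) b.
move: (x `^ a) ((1 - x) `^ b) => u v v0 u0 h.
have {h}v2 : u <= 2 by apply: h; lra.
nra.
Qed.

End PowR.

(** * The change of variable x = (1 - t)^rho and the Jacobi moments *)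

Section FractionalJacobi.
Variables (R : realType) (rho : R).
Hypothesis rho_gt0 : 0 < rho.

Let X (t : R) : R := (1 - t) `^ rho.
(** The absolute Jacobian of the decreasing change of variable: X' = - [jac]. *)
Let jac (t : R) : R := rho * (1 - t) `^ (rho - 1).

Lemma fracvar_itv (t : R) : t \in `]0, 1[ -> 0 < X t < 1.
Proof.
rewrite in_itv/= => /andP[t0 t1]; rewrite powR_gt0 ?subr_gt0//=.
have := @gt0_ltr_powR _ rho rho_gt0 (1 - t) 1; rewrite !nnegrE powR1; apply; lra.
Qed.

Lemma is_derive_fracvar (t : R) : t < 1 -> is_derive t (1 : R) X (- jac t).
Proof. exact: is_derive_onem_powR. Qed.

Lemma is_derive_horner_fracvar (p : {poly R}) (t : R) : t < 1 ->
  is_derive t (1 : R) (fun t => p.[X t]) (- (jac t * p^`().[X t])).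
Proof.
move=> t1.
have h := is_derive1_comp (g := X) (is_derive_poly p (X t)) (is_derive_fracvar t1).
by apply: is_derive_eq h _; rewrite mulrN mulrC.
Qed.

Lemma is_derive_onem_fracvar_powR (c t : R) : t \in `]0, 1[ ->
  is_derive t (1 : R) (fun t => (1 - X t) `^ c) (jac t * (c * (1 - X t) `^ (c - 1))).
Proof.
move=> t01; have /andP[_ X1] := fracvar_itv t01.
have t1 : t < 1 by move: t01; rewrite in_itv/= => /andP[].
have h := is_derive1_comp (g := X) (is_derive_onem_powR c X1) (is_derive_fracvar t1).
by apply: is_derive_eq h _; rewrite mulrNN mulrC.
Qed.

(** Exhibits the weight as the pull-back of x^a (1-x)^b dx along [X]; the exponents match since rho
    - 1 + rho a = rho (a + 1) - 1. *)
Lemma weightE a b (t : R) : t < 1 ->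
  weight a b rho t = jac t * X t `^ a * (1 - X t) `^ b.
Proof.
move=> t1; rewrite /weight /jac /X; congr (_ * _).
rewrite -mulrA; congr (_ * _); rewrite -powRrM -powRD.
  by congr (_ `^ _); ring.
by rewrite subr_eq0 (gt_eqF t1) implybT.
Qed.

Lemma continuous_weight a b :
  {in `]0, 1[, forall t, {for t, continuous (weight a b rho)}}.
Proof.
move=> t t01; have t1 : t < 1 by move: t01; rewrite in_itv/= => /andP[].
apply: (@continuousM R R).
  apply: (@continuousM R R); first exact: cvg_cst.
  exact: is_derive1_continuous (is_derive_onem_powR _ t1).
exact: is_derive1_continuous (is_derive_onem_fracvar_powR b t01).
Qed.

Lemma continuous_horner_fracvar (p : {poly R}) (t : R) : t < 1 ->
  {for t, continuous (fun t => p.[X t])}.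
Proof. by move=> t1; exact: is_derive1_continuous (is_derive_horner_fracvar p t1). Qed.

Lemma continuous_horner_weight a b (p : {poly R}) :
  {in `]0, 1[, forall t, {for t, continuous (fun t => p.[X t] * weight a b rho t)}}.
Proof.
move=> t t01; have t1 : t < 1 by move: t01; rewrite in_itv/= => /andP[].
apply: (@continuousM R R); first exact: continuous_horner_fracvar.
exact: continuous_weight.
Qed.

Lemma onem_fracvar_powR_cvg_right c : 0 < c -> (1 - X t) `^ c @[t --> (0 : R)^'+] --> 0.
Proof.
move=> c0; apply: powR_cvg0_comp => //.
  near=> t; have /andP[_ X1] : 0 < X t < 1.
    apply: fracvar_itv; rewrite in_itv/=; apply/andP; split; near: t.
      exact: nbhs_right_gt.
    exact: nbhs_right_lt.
  by rewrite subr_gt0.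
rewrite -[Z in _ --> Z](subrr (1 : R)); apply: cvgB; first exact: cvg_cst.
exact: onem_powR_cvg_right.
Unshelve. all: by end_near. Qed.

Lemma onem_fracvar_powR_cvg_left c : (1 - X t) `^ c @[t --> (1 : R)^'-] --> (1 : R).
Proof.
have h := is_derive1_continuous (is_derive_onem_powR c (@ltr01 R)).
have E : (1 - 0) `^ c = 1 :> R by rewrite subr0 powR1.
rewrite -[Z in _ --> Z]E.
apply: (@continuous_cvg _ _ _ _ _ X (fun x => (1 - x) `^ c)) => //.
exact: onem_powR_cvg_left.
Qed.

Lemma horner_fracvar_cvg_left (p : {poly R}) : p.[X t] @[t --> (1 : R)^'-] --> p.[0].
Proof.
apply: (@continuous_cvg _ _ _ _ _ X (horner p)); first exact: continuous_horner.
exact: onem_powR_cvg_left.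
Qed.

Lemma horner_fracvar_cvg_right (p : {poly R}) : p.[X t] @[t --> (0 : R)^'+] --> p.[1].
Proof.
apply: (@continuous_cvg _ _ _ _ _ X (horner p)); first exact: continuous_horner.
exact: onem_powR_cvg_right.
Qed.

Section Weight.
Variables (a b : R).
Hypotheses (a_gt : -1 < a) (b_gt : -1 < b).

(** A majorant with separated end-point singularities: unlike the product of the two powers, their
    sum has the elementary antiderivative [Dom], with finite limits at both ends since a + 1 and b +
    1 are positive. *)
Let dom (M t : R) : R := M * (jac t * X t `^ a + jac t * (1 - X t) `^ b).
Let Dom (M t : R) : R :=
  M * (- ((a + 1)^-1 * X t `^ (a + 1)) + (b + 1)^-1 * (1 - X t) `^ (b + 1)).

Let is_derive_Dom M : {in `]0, 1[, forall t, is_derive t (1 : R) (Dom M) (dom M t)}.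
Proof.
move=> t t01; have t1 : t < 1 by move: t01; rewrite in_itv/= => /andP[].
have /andP[X0 X1] := fracvar_itv t01.
have a1 : 0 < a + 1 by rewrite -ltrBlDr sub0r.
have b1 : 0 < b + 1 by rewrite -ltrBlDr sub0r.
have h1 := is_derive1_comp (g := X) (is_derive1_powR (a + 1) X0) (is_derive_fracvar t1).
have h2 := is_derive_onem_fracvar_powR (b + 1) t01.
have h := is_deriveZ M (is_deriveD (is_deriveN (is_deriveZ (a + 1)^-1 h1))
                                   (is_deriveZ (b + 1)^-1 h2)).
apply: is_derive_eq h _; rewrite /dom /GRing.scale /= !addrK.
by field; rewrite !gt_eqF.
Qed.

Let Dom_cvg M : exists m0 m1 : R, Dom M t @[t --> (0 : R)^'+] --> m0 /\
  Dom M t @[t --> (1 : R)^'-] --> m1.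
Proof.
have a1 : 0 < a + 1 by rewrite -ltrBlDr sub0r.
have b1 : 0 < b + 1 by rewrite -ltrBlDr sub0r.
have Xa t : X t `^ (a + 1) = (1 - t) `^ (rho * (a + 1)) by rewrite powRrM.
exists (M * (- ((a + 1)^-1 * 1) + (b + 1)^-1 * 0)).
exists (M * (- ((a + 1)^-1 * 0) + (b + 1)^-1 * 1)).
split; (apply: cvgM; [exact: cvg_cst|apply: cvgD;
  [apply: cvgN; apply: cvgM; [exact: cvg_cst|]|apply: cvgM; [exact: cvg_cst|]]]).
- by under eq_fun do rewrite Xa; exact: onem_powR_cvg_right.
- exact: onem_fracvar_powR_cvg_right.
- by under eq_fun do rewrite Xa; apply: onem_powR_cvg_left; exact: mulr_gt0.
- exact: onem_fracvar_powR_cvg_left.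
Qed.

Let continuous_dom M : {in `]0, 1[, forall t, {for t, continuous (dom M)}}.
Proof.
move=> t t01; have t1 : t < 1 by move: t01; rewrite in_itv/= => /andP[].
have /andP[X0 X1] := fracvar_itv t01.
have cj : {for t, continuous jac}.
  apply: (@continuousM R R); first exact: cvg_cst.
  exact: is_derive1_continuous (is_derive_onem_powR _ t1).
apply: (@continuousM R R); first exact: cvg_cst.
apply: (@continuousD _ _ R); apply: (@continuousM R R) => //.
  exact: is_derive1_continuous
    (is_derive1_comp (g := X) (is_derive1_powR a X0) (is_derive_fracvar t1)).
exact: is_derive1_continuous (is_derive_onem_fracvar_powR b t01).
Qed.

Let horner_weight_dom (p : {poly R}) : exists M : R,
  {in `]0, 1[, forall t, `|p.[X t] * weight a b rho t| <= dom M t}.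
Proof.
have [M pM] := poly_itv_bound p 0 1.
have M0 : 0 <= M by apply: le_trans (pM 0 _) => //; rewrite lexx ler01.
(* [M] bounds the polynomial on [0, 1]; the 2 is the constant of [powRM_onem_le]. *)
exists (M * 2) => t t01; have t1 : t < 1 by move: t01; rewrite in_itv/= => /andP[].
have X01 := fracvar_itv t01.
have /andP[X0 X1] := X01.
have j0 : 0 <= jac t by rewrite mulr_ge0 ?powR_ge0// ltW.
rewrite normrM weightE// /dom; move: (jac t) j0 => j j0.
rewrite (ger0_norm (x := j * _ * _)); last by rewrite !mulr_ge0 ?powR_ge0.
rewrite -mulrDr -!mulrA; apply: ler_pM => //; first by rewrite !mulr_ge0 ?powR_ge0.
  by apply: pM; rewrite !ltW.
by rewrite [leRHS]mulrCA; apply: ler_wpM2l => //; exact: powRM_onem_le.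
Qed.

Lemma integrable_horner_weight (p : {poly R}) :
  (@lebesgue_measure R).-integrable `]0, 1[
    (EFin \o (fun t => p.[X t] * weight a b rho t)).
Proof.
have [M hM] := horner_weight_dom p; have [m0 [m1 [c0 c1]]] := Dom_cvg M.
apply: (integrable_FTC2_oo ltr01 hM _ _ _ c0 c1).
- exact: continuous_horner_weight.
- exact: continuous_dom.
- exact: is_derive_Dom.
Qed.

(** The concrete instance of the abstract functional [L]. For a, b > -1 the real-valued integral is
    faithful, by [integrable_horner_weight]. *)
Definition jacobi_moment (p : {poly R}) : R :=
  \int[@lebesgue_measure R]_(t in `]0, 1[) (p.[X t] * weight a b rho t).

Lemma jacobi_moment_scalar : scalar jacobi_moment.
Proof.
move=> c p q; rewrite /jacobi_moment -RintegralZl//; last exact: integrable_horner_weight.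
rewrite -RintegralD//.
- by apply: eq_Rintegral => t _; rewrite hornerD hornerZ mulrDl -mulrA.
- rewrite (_ : _ \o _ = EFin \o (fun t => (c *: p).[X t] * weight a b rho t)).
    exact: integrable_horner_weight.
  by apply/funext => t /=; rewrite hornerZ -mulrA.
- exact: integrable_horner_weight.
Qed.

Lemma weight_ge0 t : 0 <= weight a b rho t.
Proof. by rewrite !mulr_ge0 ?powR_ge0// ltW. Qed.

Lemma jacobi_moment_sqr_ge0 p : 0 <= jacobi_moment (p ^+ 2).
Proof.
by apply: Rintegral_ge0 => t _; rewrite horner_exp mulr_ge0 ?sqr_ge0 ?weight_ge0.
Qed.

(** The integrand has the antiderivative [F], whose minus sign compensates that of X'. [F] tends to
    0 at t = 0 through the power of 1 - X and at t = 1 through the power of X. *)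
Lemma jacobi_moment_ibp q :
  jacobi_moment ('X * (1 - 'X) * q^`() + ((a + 1) *: (1 - 'X) - (b + 1) *: 'X) * q) = 0.
Proof.
set r : {poly R} := (X in jacobi_moment X).
(* The integrand may change sign, so [FTC2_oo] is used and needs a majorant. *)
have [M hM] := horner_weight_dom r; have [m0 [m1 [c0 c1]]] := Dom_cvg M.
have a1 : 0 < a + 1 by rewrite -ltrBlDr sub0r.
have b1 : 0 < b + 1 by rewrite -ltrBlDr sub0r.
pose F t := - (X t `^ (a + 1) * ((1 - X t) `^ (b + 1) * q.[X t])).
have dF : {in `]0, 1[, forall t, is_derive t (1 : R) F (r.[X t] * weight a b rho t)}.
  move=> t t01; have t1 : t < 1 by move: t01; rewrite in_itv/= => /andP[].
  have /andP[X0 X1] := fracvar_itv t01.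
  have h1 := is_derive1_comp (g := X) (is_derive1_powR (a + 1) X0) (is_derive_fracvar t1).
  have h2 := is_derive_onem_fracvar_powR (b + 1) t01.
  have h3 := is_derive_horner_fracvar q t1.
  have h := is_deriveN (is_deriveM h1 (is_deriveM h2 h3)).
  have rE : r.[X t] = X t * (1 - X t) * q^`().[X t] +
      ((a + 1) * (1 - X t) - (b + 1) * X t) * q.[X t] by rewrite /r !hornerE.
  apply: is_derive_eq h _; rewrite weightE// !fctE /GRing.scale /= !addrK rE.
  rewrite !powRD1 ?subr_gt0//.
  by move: (jac t) => j; ring.
have Xa t : X t `^ (a + 1) = (1 - t) `^ (rho * (a + 1)) by rewrite powRrM.
have F0 : F t @[t --> (0 : R)^'+] --> - (1 * (0 * q.[1])).
  apply: cvgN; apply: cvgM.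
    by under eq_fun do rewrite Xa; exact: onem_powR_cvg_right.
  apply: cvgM; first exact: onem_fracvar_powR_cvg_right.
  exact: horner_fracvar_cvg_right.
have F1 : F t @[t --> (1 : R)^'-] --> - (0 * (1 * q.[0])).
  apply: cvgN; apply: cvgM.
    by under eq_fun do rewrite Xa; apply: onem_powR_cvg_left; exact: mulr_gt0.
  apply: cvgM; first exact: onem_fracvar_powR_cvg_left.
  exact: horner_fracvar_cvg_left.
have cr : {in `]0, 1[, forall t,
    {for t, continuous (fun t => r.[X t] * weight a b rho t)}}.
  exact: continuous_horner_weight.
rewrite /jacobi_moment /Rintegral.
rewrite (FTC2_oo ltr01 hM cr (@continuous_dom M) dF (@is_derive_Dom M) F0 F1 c0 c1)/=.
by rewrite !mul0r mulr0 oppr0 subrr.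
Qed.

End Weight.
End FractionalJacobi.

(** * Weighted norms of fractional polynomials and the two inverse estimates *)

Section FractionalNorms.
Variables (R : realType) (rho : R).
Hypothesis rho_gt0 : 0 < rho.

Let X (t : R) : R := (1 - t) `^ rho.

(** Raising both parameters multiplies the weight by X (1 - X), the factor in [Jacobi_markov]. *)
Lemma jacobi_momentS a b q :
  jacobi_moment rho (a + 1) (b + 1) q = jacobi_moment rho a b ('X * (1 - 'X) * q).
Proof.
apply: eq_Rintegral => t /set_mem/= t01.
have t1 : t < 1 by move: t01; rewrite in_itv/= => /andP[].
have /andP[X0 X1] := fracvar_itv rho_gt0 t01.
rewrite !weightE// -/(X t) !powRD1 ?subr_gt0//.
rewrite !(hornerM, hornerD, hornerN, hornerX, hornerC).
by move: (rho * _) => j; rewrite /X; ring.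
Qed.

Lemma jacobi_moment_markov a b N (p : {poly R}) : -1 < a -> -1 < b ->
  (size p <= N.+1)%N ->
  jacobi_moment rho (a + 1) (b + 1) (p^`() ^+ 2) <=
    sigmaN a b N * jacobi_moment rho a b (p ^+ 2).
Proof.
move=> a1 b1 sp; rewrite jacobi_momentS; apply: Jacobi_markov => //.
- exact: jacobi_moment_scalar.
- exact: jacobi_moment_sqr_ge0.
- exact: jacobi_moment_ibp.
- lra.
Qed.

(** The end points are negligible, so agreement inside is enough. Comparing the products
    [f t ^+ 2 * w t], not [f] alone, lets the lemma also treat the derivative under [tweight]. *)
Lemma wnorm_moment a b (w f : R -> R) (p : {poly R}) : -1 < a -> -1 < b ->
  {in `]0, 1[, forall t, f t ^+ 2 * w t = p.[X t] ^+ 2 * weight a b rho t} ->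
  wnorm w f = (Num.sqrt (jacobi_moment rho a b (p ^+ 2)))%:E.
Proof.
move=> a1 b1 fw.
have fw' : {in `]0, 1[%classic, (fun t => (p ^+ 2).[X t] * weight a b rho t) =1
    (fun t => f t ^+ 2 * w t)}.
  by move=> t /set_mem/= t01; rewrite fw// horner_exp.
have ip := integrable_horner_weight rho_gt0 a1 b1 (p ^+ 2).
rewrite /wnorm /unitJ integral_itv_bndoo; last first.
  apply/measurable_EFinP; apply: (eq_measurable_fun _ fw').
  by apply/measurable_EFinP; exact: measurable_int ip.
have -> : (\int[@lebesgue_measure R]_(t in `]0%R, 1%R[) (f t ^+ 2 * w t)%:E)%E =
    (jacobi_moment rho a b (p ^+ 2))%:E.
  rewrite /jacobi_moment /Rintegral fineK; last exact: integrable_fin_num ip.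
  by apply: eq_integral => t t01; rewrite -fw'.
by rewrite poweR_EFin powR12_sqrt ?jacobi_moment_sqr_ge0.
Qed.

Lemma wnorm_weight a b (f : R -> R) (p : {poly R}) : -1 < a -> -1 < b ->
  {in `]0, 1[, forall t, f t = p.[X t]} ->
  wnorm (weight a b rho) f = (Num.sqrt (jacobi_moment rho a b (p ^+ 2)))%:E.
Proof. by move=> a1 b1 fp; apply: wnorm_moment => // t t01; rewrite fp. Qed.

Lemma fracpoly_horner N (phi : R -> R) : fracpoly rho N phi ->
  exists2 p : {poly R}, (size p <= N.+1)%N & {in `]0, 1[, forall t, phi t = p.[X t]}.
Proof.
case=> c phiE; exists (\poly_(i < N.+1) c (inord i)); first exact: size_poly.
move=> t t01; rewrite phiE; last exact: subset_itv_oo_cc t01.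
rewrite horner_poly; apply: eq_bigr => i _; rewrite inord_val /X.
by rewrite [i%:R * rho]mulrC powRrM powR_mulrn ?powR_ge0.
Qed.

Lemma derive1_fracvar (f : R -> R) (p : {poly R}) :
  {in `]0, 1[, forall t, f t = p.[X t]} ->
  {in `]0, 1[, forall t,
    (f^`())%classic t = - (rho * (1 - t) `^ (rho - 1) * p^`().[X t])}.
Proof.
move=> fp t t01; have t1 : t < 1 by move: t01; rewrite in_itv/= => /andP[].
have [_ <-] := is_derive_horner_fracvar rho p t1.
(* [f] coincides with the polynomial in [X] on a whole neighbourhood of the interior point [t]. *)
rewrite derive1E; apply: near_eq_derive.
have := near_in_itvoo t01.
by apply: filterS => s; exact: fp.
Qed.

Lemma Drho_fracvar (f : R -> R) (p : {poly R}) :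
  {in `]0, 1[, forall t, f t = p.[X t]} ->
  {in `]0, 1[, forall t, Drho rho f t = (- p^`()).[X t]}.
Proof.
move=> fp t t01; have t1 : t < 1 by move: t01; rewrite in_itv/= => /andP[].
rewrite /Drho (derive1_fracvar fp t01) hornerN mulrN; congr (- _).
have -> : 1 - rho = - (rho - 1) by rewrite opprB.
rewrite powRN; field.
by rewrite gt_eqF//= gt_eqF// powR_gt0// subr_gt0.
Qed.

Lemma wnorm_derive1 mu upsilon N (phi : R -> R) : -1 < mu -> -1 < upsilon ->
  (1 <= N)%N -> fracpoly rho N phi ->
  (wnorm (tweight mu upsilon rho) (phi^`())%classic
   <= (Num.sqrt (sigmaN mu upsilon N))%:E * wnorm (weight mu upsilon rho) phi)%E.
Proof.
move=> hmu hup N1 /fracpoly_horner[p sp phip].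
rewrite (wnorm_weight hmu hup phip) (@wnorm_moment (mu + 1) (upsilon + 1) _ _ p^`()).
- rewrite -EFinM lee_fin -sqrtrM; last first.
    (* N >= 1 and mu + upsilon > -2 make [sigmaN] nonnegative, as splitting the square root
       requires. *)
    rewrite mulr_ge0//; have : 1 <= N%:R :> R by rewrite ler1n.
    by lra.
  by rewrite ler_wsqrtr// jacobi_moment_markov.
- by lra.
- by lra.
move=> t t01; rewrite (derive1_fracvar phip t01).
have t1 : 0 < 1 - t by move: t01; rewrite in_itv/= subr_gt0 => /andP[].
rewrite /tweight /weight.
(* [tweight] absorbs the squared chain-rule factor: multiplied by it, it becomes the weight with
   parameters mu + 1 and upsilon + 1. *)
have -> : (1 - t) `^ (rho * mu + 1) = (1 - t) `^ (rho * (mu + 1 + 1) - 1) *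
    ((1 - t) `^ (rho - 1))^-1 * ((1 - t) `^ (rho - 1))^-1.
  rewrite -!powRN -!powRD ?(gt_eqF t1) ?implybT//.
  by congr (_ `^ _); ring.
have : (1 - t) `^ (rho - 1) != 0 by rewrite gt_eqF// powR_gt0.
move: ((1 - t) `^ (rho - 1)) => u u0; field.
by rewrite u0 gt_eqF.
Qed.

(** For N >= 1, N + a + b + 1 is at most (|a + b| + 2) N. The constant depends only on a + b. *)
Lemma sqrt_sigmaN_le (a b : R) N : (1 <= N)%N ->
  Num.sqrt (sigmaN a b N) <= Num.sqrt (`|a + b| + 2) * N%:R.
Proof.
move=> N1; have N1' : 1 <= N%:R :> R by rewrite ler1n.
rewrite -(ger0_norm (ler0n R N)) -(sqrtr_sqr N%:R) -sqrtrM ?addr_ge0//.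
rewrite ler_wsqrtr// /sigmaN mulrC expr2 [leRHS]mulrA ler_wpM2r//.
have := ler_norm (a + b); have := normr_ge0 (a + b).
move: (N%:R) N1' => n n1; nra.
Qed.

(** Induction on [k] with [a] and [b] general, as each [Drho] raises both by 1 and costs a factor of
    order N. Agreement with a polynomial is asked only on the open interval, which is what [Drho f]
    inherits. The constant is the product of the square roots of |a + b + 2i| + 2 for i < k. *)
Lemma wnorm_iter_Drho k a b : -1 < a -> -1 < b ->
  exists2 c : R, 0 < c & forall N (f : R -> R) (p : {poly R}),
    (1 <= N)%N -> (size p <= N.+1)%N -> {in `]0, 1[, forall t, f t = p.[X t]} ->
    (wnorm (weight (a + k%:R) (b + k%:R) rho) (iter k (Drho rho) f)
     <= (c * N%:R ^+ k)%:E * wnorm (weight a b rho) f)%E.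
Proof.
elim: k a b => [|k IHk] a b a1 b1.
  by exists 1 => // N f p _ _ _; rewrite expr0 mulr1 mul1e !addr0.
have a1' : -1 < a + 1 by lra.
have b1' : -1 < b + 1 by lra.
have [c c0 cP] := IHk _ _ a1' b1'.
have K0 : 0 < Num.sqrt (`|a + b| + 2) by rewrite sqrtr_gt0 ltr_wpDl.
exists (c * Num.sqrt (`|a + b| + 2)) => [|N f p N1 sp fp]; first exact: mulr_gt0.
have Dfp := Drho_fracvar fp.
(* The drop in degree is not exploited: the same [N] serves at every step. *)
have sDp : (size (- p^`())%R <= N.+1)%N.
  by rewrite size_polyN (leq_trans (size_poly _ _))// (leq_trans (leq_pred _)).
have := cP N _ _ N1 sDp Dfp.
rewrite -iterSr -!addrA !nat1r => /le_trans; apply.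
rewrite (wnorm_weight a1' b1' Dfp) (wnorm_weight a1 b1 fp) -!EFinM lee_fin.
have -> : c * Num.sqrt (`|a + b| + 2) * N%:R ^+ k.+1 =
  c * N%:R ^+ k * (Num.sqrt (`|a + b| + 2) * N%:R) by rewrite exprS; ring.
rewrite -[leRHS]mulrA ler_wpM2l ?mulr_ge0 ?exprn_ge0 ?(ltW c0)//.
rewrite sqrrN (le_trans (ler_wsqrtr (jacobi_moment_markov a1 b1 sp)))//.
rewrite sqrtrM; last first.
  rewrite mulr_ge0//; have : 1 <= N%:R :> R by rewrite ler1n.
  by lra.
by rewrite ler_wpM2r ?sqrtr_ge0// sqrt_sigmaN_le.
Qed.

End FractionalNorms.

Theorem proposition4p2 (R : realType) (mu upsilon rho : R)
    (hmu : -1 < mu) (hupsilon : -1 < upsilon) (hrho0 : 0 < rho)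
    (hrho1 : rho <= 1) :
  (forall (N : nat) (phi : R -> R), (1 <= N)%N -> fracpoly rho N phi ->
    (wnorm (tweight mu upsilon rho) (phi^`())%classic
     <= (Num.sqrt (sigmaN mu upsilon N))%:E
        * wnorm (weight mu upsilon rho) phi)%E)
  /\
  (forall k : nat, (1 <= k)%N ->
    exists c : R, 0 < c /\
      forall (N : nat) (phi : R -> R), (1 <= N)%N -> fracpoly rho N phi ->
        (wnorm (weight (mu + k%:R) (upsilon + k%:R) rho)
               (iter k (Drho rho) phi)
         <= (c * N%:R ^+ k)%:E * wnorm (weight mu upsilon rho) phi)%E).
Proof.
split=> [N phi N1 phiP|k _]; first exact: wnorm_derive1.
have [c c0 cP] := wnorm_iter_Drho hrho0 k hmu hupsilon.
exists c; split=> // N phi N1 /(fracpoly_horner (rho := rho))[p sp phip].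
exact: cP sp phip.
Qed.
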